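(* For any $\lambda > 0$ there exist constants $k_0$ and $\tau > 0$, depending only on $\lambda$, such that $$\sum_{1 \le n \le N} S(n,a;q) \ll_{\lambda} N q^{1/2-\tau}$$ holds uniformly for any $q = p^k$ with $p$ an odd prime and $k \ge k_0$ an integer, any integer $a$ satisfying $\gcd(a,p)=1$, and any $N$ with $q^{\lambda} \le N \le q$.
   Context: For integers $n$, $a$ and $q \ge 1$, the Kloosterman sum is $$S(n,a;q) := \sum_{\substack{b \bmod q \\ \gcd(b,q)=1}} e\left(\frac{nb + a\bar{b}}{q}\right),$$ where $e(x) = e^{2\pi i x}$ and $\bar{b}$ is the multiplicative inverse of $b$ modulo $q$. The notation $U \ll_\lambda V$ means $|U| \le cV$ for some constant $c>0$ depending only on $\lambda$. Sums over $n$ are over integers. *)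

(* Defs.v *)
From HB Require Import structures.
From mathcomp Require Import all_boot all_order all_algebra.
From mathcomp Require Export complex.
From mathcomp Require Import reals exp trigo.

Set Implicit Arguments.
Unset Strict Implicit.
Unset Printing Implicit Defensive.

Import Order.TTheory GRing.Theory Num.Theory.

Local Open Scope ring_scope.

(* e(x) = e^{2 pi i x}; the analysis library has no complex exponential. *)
Definition e (R : realType) (x : R) : R[i] :=
  (cos (2 * pi * x) +i* sin (2 * pi * x))%C.

(* A representative of the inverse of b modulo q, read off from a Bezout
   relation; meaningful only when b and q are coprime. *)
Definition modinv (q b : nat) : nat := (egcdn b q).1.

Lemma modinvP (q b : nat) : (0 < q)%N -> coprime b q ->
  (b * modinv q b = 1 %[mod q])%N.
Proof.
rewrite /modinv; case: b => [|b] q_gt0 cop.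
  by move: cop; rewrite /coprime gcd0n => /eqP->; rewrite !modn1.
case: egcdnP => // u v /= uv _.
by rewrite mulnC uv (eqP cop) modnMDl.
Qed.

Definition kloosterman (R : realType) (n a : int) (q : nat) : R[i] :=
  \sum_(b < q | coprime b q)
    e ((n * (b : nat)%:Z + a * (modinv q b)%:Z)%:~R / q%:R : R).

(* Main.v *)
Require Import Defs.
From mathcomp Require Import all_boot all_order all_algebra.
From mathcomp Require Import reals exp trigo.
From mathcomp Require Import ring lra zify.

(** Let q = p ^ k and N >= q ^ lambda. Since k is large, p is a tiny power of q,
    so any loss of a bounded power of p is harmless, and the interval [1, N]
    splits into residue classes modulo a power p ^ s that are still long: their
    length is at least p ^ s.

    On a class n + p ^ s t with n prime to p, the integers n + p ^ s t are
    n u(t) ^ 2 modulo q, where u is the Taylor polynomial of a square root, of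
    degree D + 1 bounded in terms of lambda (sqrt_poly_class). The substitution
    b -> b / u(t) turns the Kloosterman sum into
        sum over b of e (u(t) (n b + a / b) / q),
    where u(t) is a mere factor of the phase (kloosterman_square). Splitting b
    modulo p ^ (k - floor (k / 2)) leaves only the stationary points
    n b ^ 2 = a modulo p ^ floor (k / 2), a condition that does not involve t
    (kloosterman_stationary). Up to bounded powers of p there are two of them
    (card_sqrt_le), each weighted by q ^ (1 / 2), which accounts for the square
    root of q.

    For each stationary b the factor z = n b + a / b is a unit, so the sum over
    t of e (z u(t) / q) is a Weyl sum whose leading coefficient has a controlled
    denominator: u is explicit, with Catalan numbers as coefficients, and the
    powers of p contributed by its (D + 1)-st difference are bounded in terms of
    D alone (sqrt_lead_neq0). Differencing D times by van der Corput's
    inequality, with shifts smaller than p ^ j, reduces it to linear sums with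
    complete cancellation and saves the factor p ^ (j / 2 ^ D) (weyl_sum_le),
    that is, a fixed power of q. If p divides n there are no stationary points at all. *)

Import Order.TTheory GRing.Theory Num.Theory.
Import Normc.

Local Open Scope ring_scope.
Local Open Scope complex_scope.

(** * Additive characters modulo q *)

Section Characters.

Variable R : realType.

Definition chi (q : nat) (z : int) : R[i] := e (z%:~R / q%:R).

Lemma eD (x y : R) : e (x + y) = e x * e y.
Proof.
rewrite /e !mulrDr cosD sinD; apply/eqP; rewrite eq_complex /=.
by rewrite eqxx /= addrC eqxx.
Qed.

Lemma e0 : e (0 : R) = 1.
Proof. by rewrite /e mulr0 cos0 sin0. Qed.

Lemma e_int (z : int) : e (z%:~R : R) = 1.
Proof.
have eN n : e (n%:R : R) = 1.
  elim: n => [|n IH]; first exact: e0.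
  rewrite -natr1 eD IH mul1r /e mulr1 mulrC mulr_natr cos2pi sin2pi.
  by [].
case: z => n; first by rewrite -pmulrn eN.
rewrite NegzE; have := eD n.+1%:R (- n.+1%:R).
by rewrite subrr e0 eN mul1r mulrNz -pmulrn.
Qed.

Lemma norm_e (x : R) : `|e x| = 1.
Proof. by rewrite normc_def /= cos2Dsin2 sqrtr1. Qed.

Lemma chiD q x y : chi q (x + y) = chi q x * chi q y.
Proof. by rewrite /chi rmorphD mulrDl eD. Qed.

Lemma chi0 q : chi q 0 = 1.
Proof. by rewrite /chi mul0r e0. Qed.

Lemma norm_chi q z : `|chi q z| = 1.
Proof. exact: norm_e. Qed.

Lemma chiM q (n : nat) z : chi q (z * n%:Z) = chi q z ^+ n.
Proof.
elim: n => [|n IH]; first by rewrite mulr0 chi0.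
by rewrite -addn1 PoszD mulrDr mulr1 chiD IH exprD.
Qed.

Lemma chi_conj q z : (chi q z)^*%R = chi q (- z).
Proof.
have z1 : chi q z * (chi q z)^*%R = 1 by rewrite -normCK norm_chi expr1n.
have z2 : chi q z * chi q (- z) = 1 by rewrite -chiD subrr chi0.
have nz : chi q z != 0 by rewrite -normr_gt0 norm_chi.
by apply: (mulfI nz); rewrite z1 z2.
Qed.

Lemma chi_dvd q z : (0 < q)%N -> (q %| z)%Z -> chi q z = 1.
Proof.
move=> q0 /dvdzP[y ->]; rewrite /chi rmorphM /=.
by rewrite -[q%:~R]pmulrn mulfK ?e_int // pnatr_eq0 -lt0n.
Qed.

(** Reduce [z] to a residue [0 <= r < q]. If [r > 0], the real part
    [cos (2 pi r / q) = 1 - 2 sin (pi r / q) ^ 2] is smaller than 1, because the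
    angle [pi r / q] lies strictly between 0 and [pi]. *)
Lemma chi_eq1 q z : (0 < q)%N -> (chi q z == 1) = (q %| z)%Z.
Proof.
move=> q0; apply/eqP/idP; last exact: chi_dvd.
have qZ : q%:Z != 0 by rewrite eqz_nat -lt0n.
have [r [rlt ->]] : exists r : nat,
    (r < q)%N /\ z = r%:Z + (z %/ q)%Z * q.
  exists `|(z %% q)%Z|%N; split; last first.
    by rewrite gez0_abs ?modz_ge0 // addrC -divz_eq.
  by have := ltz_pmod z (d := q); rewrite -ltz_nat gez0_abs ?modz_ge0 //; apply.
rewrite chiD (chi_dvd _ _ q0 (dvdz_mull _ (dvdzz _))) mulr1.
case: r rlt => [|r] rlt; first by rewrite add0r dvdz_mull ?dvdzz.
set x : R := r.+1%:R / q%:R.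
have q0R : 0 < q%:R :> R by rewrite ltr0n.
have x0 : 0 < x by rewrite divr_gt0 ?ltr0n.
have x1 : x < 1 by rewrite ltr_pdivrMr // mul1r ltr_nat.
have s0 : 0 < sin (pi * x).
  by rewrite sin_gt0_pi // mulr_gt0 ?pi_gt0 //= gtr_pMr ?pi_gt0.
rewrite /chi -pmulrn -/x /e -mulrA mulr_natl => -[+ _].
rewrite cos_mulr2n cos2sin2 => h.
have : 0 < sin (pi * x) ^+ 2 by rewrite exprn_gt0.
by lra.
Qed.

Lemma chi_congr q x y : (0 < q)%N -> (q %| x - y)%Z -> chi q x = chi q y.
Proof.
by move=> q0 h; rewrite -[x](subrK y) chiD (chi_dvd _ _ q0 h) mul1r.
Qed.

(** A nontrivial root of unity summed over a full period: [w - 1] kills the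
    sum, since [w ^ P = 1]. *)
Lemma chi_sum0 q P z : (0 < q)%N -> (q %| z * P%:Z)%Z -> ~~ (q %| z)%Z ->
  \sum_(x < P) chi q (z * x%:Z) = 0.
Proof.
move=> q0 h1 h2; under eq_bigr do rewrite chiM.
have /eqP := subrX1 (chi q z) P.
rewrite -chiM (chi_dvd _ _ q0 h1) subrr eq_sym mulf_eq0 subr_eq0.
by rewrite chi_eq1 // (negPf h2) => /eqP.
Qed.

End Characters.

Lemma sum_nat_div (V : nmodType) (W P : nat) (F : nat -> V) :
  \sum_(0 <= n < W * P) F n = \sum_(i < W) \sum_(t < P) F (i + W * t)%N.
Proof.
elim: P => [|P IH].
  rewrite muln0 big_geq // big1 // => i _; exact: big_ord0.
rewrite mulnS addnC (@big_cat_nat _ _ _ (W * P)) ?leq_addr //= IH.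
under [RHS]eq_bigr do rewrite big_ord_recr /=.
rewrite big_split /=; congr (_ + _).
by rewrite -{1}[(W * P)%N]add0n big_addn addKn big_mkord.
Qed.

(** * Transformations of Kloosterman sums *)

Lemma modz_coprime_inv (q : nat) (u : int) : coprimez u q ->
  exists v : int, (q %| u * v - 1)%Z.
Proof.
move=> /eqP cuq; have [v [w]] := Bezoutz u q; rewrite cuq => h.
exists v; have -> : u * v - 1 = - w * q by rewrite -h; ring.
exact: dvdz_mull.
Qed.

Lemma modinv_dvd (q b : nat) : (0 < q)%N -> coprime b q ->
  (q %| b%:Z * (modinv q b)%:Z - 1)%Z.
Proof.
move=> q0 cbq; rewrite -PoszM -eqz_mod_dvd (modz_nat _ q) (modz_nat 1 q).
by rewrite (modinvP q0 cbq).
Qed.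

Lemma inv_unique (q : nat) (b c c' : int) :
  (q %| b * c - 1)%Z -> (q %| b * c' - 1)%Z -> (q %| c - c')%Z.
Proof.
move=> h h'.
have -> : c - c' = c * -(b * c' - 1) + c' * (b * c - 1) by ring.
by rewrite rpredD // dvdz_mull // rpredN.
Qed.

Lemma coprimez_of_inv (q : nat) (b c : int) :
  (q %| b * c - 1)%Z -> coprimez b q.
Proof.
move=> /dvdzP[y h]; apply/coprimezP; exists (c, - y) => /=.
by rewrite mulNr -h; ring.
Qed.

Section Kloosterman.

Variable R : realType.

Lemma kloosterman_congr (q : nat) (A A' B : int) : (0 < q)%N ->
  (q %| A - A')%Z -> kloosterman R A B q = kloosterman R A' B q.
Proof.
move=> q0 h; apply: eq_bigr => b _; apply: chi_congr => //.
set c := (modinv _ _)%:Z.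
have -> : A * b%:Z + B * c - (A' * b%:Z + B * c) = b%:Z * (A - A') by ring.
exact: dvdz_mull.
Qed.

(** Substitute [b -> b v], which permutes the units modulo [q] and multiplies
    the inverses by [u]. *)
Lemma kloosterman_scale (q : nat) (A B u : int) (v : nat) : (0 < q)%N ->
  (q %| u * v%:Z - 1)%Z ->
  kloosterman R A B q = kloosterman R (A * v%:Z) (B * u) q.
Proof.
move=> q0 huv.
have cvq : coprime v q.
  by apply: (coprimez_of_inv q v%:Z u); rewrite mulrC.
pose h (b : 'I_q) : 'I_q := Ordinal (ltn_pmod (b * v) q0).
have h_inj : injective h.
  move=> x y /(congr1 val) /= hxy; apply: val_inj => /=.
  move/eqP: hxy.
  rewrite -eqz_nat -!modz_nat eqz_mod_dvd !PoszM -mulrBl.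
  rewrite Gauss_dvdzl; last by rewrite coprimez_sym.
  by rewrite -eqz_mod_dvd !modz_nat eqz_nat !modn_small // => /eqP.
rewrite /kloosterman (reindex_inj h_inj) /=.
have cop b : coprime (b * v %% q) q = coprime b q.
  by rewrite coprime_modl coprimeMl cvq andbT.
apply: eq_big => [b|b]; first by rewrite cop.
rewrite cop => cb; apply: chi_congr => //.
have hi := modinv_dvd _ _ q0 cb.
have h1 := modinv_dvd q (b * v %% q) q0 _; rewrite cop in h1.
move/(_ cb): h1; set m := (b * v %% q)%N; set c := modinv q m => h1.
have hm : (q %| m%:Z - b%:Z * v%:Z)%Z.
  by rewrite -eqz_mod_dvd -PoszM /m -modz_nat modz_mod.
have hc : (q %| c%:Z - u * (modinv q b)%:Z)%Z.
  apply: (inv_unique _ m%:Z) => //.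
  set d := (modinv q b)%:Z in hi *.
  have -> : m%:Z * (u * d) - 1 = u * d * (m%:Z - b%:Z * v%:Z)
     + (b%:Z * d) * (u * v%:Z - 1) + (b%:Z * d - 1) by ring.
  by rewrite rpredD // rpredD // dvdz_mull.
set d := (modinv q b)%:Z in hc *.
have -> : A * m%:Z + B * c%:Z - (A * v%:Z * b%:Z + B * u * d)
  = A * (m%:Z - b%:Z * v%:Z) + B * (c%:Z - u * d) by ring.
by rewrite rpredD // dvdz_mull.
Qed.

(** The step that makes the method work: when the first parameter changes by a
    square [u ^ 2], the phase [A b + B / b] is merely multiplied by [u], so the
    dependence on [u] no longer interacts with that on [b]. *)
Lemma kloosterman_square (q : nat) (A B u : int) : (0 < q)%N ->
  coprimez u q ->
  kloosterman R (A * u ^+ 2) B q = kloosterman R (A * u) (B * u) q.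
Proof.
move=> q0 cuq; have [w hw] := modz_coprime_inv _ _ cuq.
have qZ : q%:Z != 0 by rewrite eqz_nat -lt0n.
pose v := `|(w %% q)%Z|%N.
have vE : v%:Z = (w %% q)%Z by rewrite gez0_abs ?modz_ge0.
have hv : (q %| u * v%:Z - 1)%Z.
  rewrite vE; have -> : u * (w %% q)%Z - 1 = u * ((w %% q)%Z - w) + (u * w - 1).
    by ring.
  by rewrite rpredD // dvdz_mull // -eqz_mod_dvd modz_mod.
rewrite (kloosterman_scale _ _ _ _ _ q0 hv); apply: kloosterman_congr => //.
have -> : A * u ^+ 2 * v%:Z - A * u = A * u * (u * v%:Z - 1) by ring.
exact: dvdz_mull.
Qed.

(** Group the [b] modulo [P * W] by their residue [i] modulo [W]: since [W ^ 2]
    is a multiple of the modulus, the phase is affine on each class, with slope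
    [W (A - B / i ^ 2)], and the sum over the class vanishes unless that slope
    is zero modulo [P W]. *)
Lemma kloosterman_stationary (P W : nat) (A B : int) :
  (0 < P)%N -> (0 < W)%N -> (P %| W)%N ->
  kloosterman R A B (P * W) =
  P%:R * \sum_(i < W | coprime i W && (P %| A * i%:Z ^+ 2 - B)%Z)
           chi R (P * W) (A * i%:Z + B * (modinv (P * W) i)%:Z).
Proof.
move=> P0 W0 PW; set q := (P * W)%N.
have q0 : (0 < q)%N by rewrite muln_gt0 P0.
have copE i t : coprime (i + W * t) q = coprime i W.
  have cW : coprime (i + W * t) W = coprime i W.
    by rewrite -coprime_modl addnC mulnC modnMDl coprime_modl.
  rewrite coprimeMr cW andb_idl // => cW'.
  by apply: coprime_dvdr PW _; rewrite cW.
rewrite /kloosterman -(big_mkord (fun b => coprime b q)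
  (fun b => chi R q (A * b%:Z + B * (modinv q b)%:Z))) big_mkcond /=.
have -> : q = (W * P)%N by rewrite mulnC.
rewrite sum_nat_div mulnC -/q mulr_sumr [RHS]big_mkcond /=.
apply: eq_bigr => i _.
under eq_bigr do rewrite copE.
case: (boolP (coprime i W)) => ci /=; last by rewrite big1.
have ciq : coprime i q by rewrite -[i : nat]addn0 -[0%N](muln0 W) copE.
have hi := modinv_dvd _ _ q0 ciq; set c := (modinv q i)%:Z in hi *.
have qWP : q%:Z = W%:Z * P%:Z by rewrite -PoszM mulnC.
have qWW : (q %| W%:Z * W%:Z)%Z by rewrite qWP dvdz_mul ?dvdzz.
have step t : chi R q (A * (i + W * t)%N%:Z + B * (modinv q (i + W * t))%:Z) =
    chi R q (A * i%:Z + B * c) * chi R q (W%:Z * (A - B * c ^+ 2) * t%:Z).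
  rewrite -chiD; apply: chi_congr => //.
  have ht := modinv_dvd q (i + W * t) q0; rewrite copE in ht; move/(_ ci): ht.
  rewrite PoszD PoszM; set d := (modinv _ _)%:Z => ht.
  (* First-order expansion of [1 / (i + W t)] around [c = 1 / i]. *)
  have hd : (q %| d - (c - W%:Z * t%:Z * c ^+ 2))%Z.
    apply: (inv_unique _ (i%:Z + W%:Z * t%:Z)) => //.
    have -> : (i%:Z + W%:Z * t%:Z) * (c - W%:Z * t%:Z * c ^+ 2) - 1 =
      (1 - W%:Z * t%:Z * c) * (i%:Z * c - 1)
      - t%:Z ^+ 2 * c ^+ 2 * (W%:Z * W%:Z).
      by ring.
    by rewrite rpredB // dvdz_mull.
  have -> : A * (i%:Z + W%:Z * t%:Z) + B * d -
      (A * i%:Z + B * c + W%:Z * (A - B * c ^+ 2) * t%:Z) =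
      B * (d - (c - W%:Z * t%:Z * c ^+ 2)) by ring.
  exact: dvdz_mull.
under eq_bigr do rewrite step.
rewrite -mulr_sumr.
have statE : (q %| W%:Z * (A - B * c ^+ 2))%Z = (P %| A * i%:Z ^+ 2 - B)%Z.
  rewrite qWP dvdz_mul2l ?eqz_nat -?lt0n //.
  have Pq : (P %| i%:Z * c - 1)%Z.
    by apply: dvdz_trans hi; rewrite qWP dvdz_mull ?dvdzz.
  apply/idP/idP => h.
    have -> : A * i%:Z ^+ 2 - B = i%:Z ^+ 2 * (A - B * c ^+ 2)
      + B * (i%:Z * c + 1) * (i%:Z * c - 1) by ring.
    by rewrite rpredD // dvdz_mull.
  have -> : A - B * c ^+ 2 = c ^+ 2 * (A * i%:Z ^+ 2 - B)
     - A * (i%:Z * c + 1) * (i%:Z * c - 1) by ring.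
  by rewrite rpredB // dvdz_mull.
case: ifP => hst.
  have -> : \sum_(t < P) chi R q (W%:Z * (A - B * c ^+ 2) * t%:Z) = P%:R.
    rewrite (eq_bigr (fun=> 1)) ?sumr_const ?card_ord // => t _.
    by rewrite chi_dvd // dvdz_mulr // statE.
  by rewrite mulrC.
rewrite chi_sum0 ?mulr0 // ?statE ?hst //.
have -> : W%:Z * (A - B * c ^+ 2) * P%:Z = (A - B * c ^+ 2) * (W%:Z * P%:Z).
  by ring.
by rewrite -qWP dvdz_mull ?dvdzz.
Qed.

End Kloosterman.

(** * Quadratic congruences modulo prime powers *)

Lemma prime_coprimez (p : nat) (x : int) :
  prime p -> coprimez p x = ~~ (p %| x)%Z.
Proof. exact: prime_coprime. Qed.

Lemma prime_pow_coprimez (p m : nat) (x : int) :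
  prime p -> ~~ (p %| x)%Z -> coprimez (p ^ m)%N x.
Proof. by move=> p_pr np; apply: coprimeXl; rewrite prime_coprime. Qed.

(** Two solutions [b], [b'] satisfy [p ^ m | (b - b') (b + b')], and [p] cannot
    divide both factors because it does not divide [2 b]. *)
Lemma card_sqrt_le (p m d : nat) (A B : int) :
  prime p -> odd p -> (0 < m)%N -> coprimez B p ->
  (#|[pred b : 'I_(p ^ m * p ^ d) | ((p ^ m)%N %| (A * b%:Z ^+ 2 - B)%R)%Z]|
     <= 2 * p ^ d)%N.
Proof.
move=> p_pr p_odd m0 cBp; set P := (p ^ m)%N; set S := [pred b | _].
have P0 : (0 < P)%N by rewrite expn_gt0 prime_gt0.
have pP : (p %| P)%N by rewrite /P -(prednK m0) expnS dvdn_mulr.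
have [b0 Sb0|S0] := pickP S; last by rewrite eq_card0.
have nBp : ~~ (p %| B)%Z by rewrite -prime_coprimez // coprimez_sym.
have pSb0 : (p %| A * b0%:Z ^+ 2 - B)%Z by apply: dvdz_trans Sb0.
have nA : ~~ (p %| A)%Z.
  apply: contra nBp => pA.
  have -> : B = b0%:Z ^+ 2 * A - (A * b0%:Z ^+ 2 - B) by ring.
  by rewrite rpredB // dvdz_mull.
have n2b : ~~ (p %| 2 * b0%:Z)%Z.
  apply: contra nBp => p2b.
  have pb : (p %| b0%:Z)%Z.
    move: p2b; rewrite Gauss_dvdzr // prime_coprimez //.
    apply/negP => /(dvdn_leq (isT : (0 < 2)%N)).
    by case: (p) p_pr p_odd => [|[|[|]]].
  have -> : B = (A * b0%:Z) * b0%:Z - (A * b0%:Z ^+ 2 - B) by ring.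
  by rewrite rpredB // dvdz_mull.
have alt b : S b -> ~~ (P %| b%:Z - b0%:Z)%Z -> (P %| b%:Z + b0%:Z)%Z.
  move=> Sb nminus.
  have prod : (P %| (b%:Z - b0%:Z) * (b%:Z + b0%:Z))%Z.
    have : (P %| A * ((b%:Z - b0%:Z) * (b%:Z + b0%:Z)))%Z.
      have -> : A * ((b%:Z - b0%:Z) * (b%:Z + b0%:Z)) =
        (A * b%:Z ^+ 2 - B) - (A * b0%:Z ^+ 2 - B) by ring.
      by rewrite rpredB.
    by rewrite Gauss_dvdzr // prime_pow_coprimez.
  case: (boolP (p %| b%:Z + b0%:Z)%Z) => [pp|np].
    rewrite -(Gauss_dvdzr _ (n := b%:Z - b0%:Z)) // prime_pow_coprimez //.
    apply: contra n2b => pm.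
    have -> : 2 * b0%:Z = (b%:Z + b0%:Z) - (b%:Z - b0%:Z) by ring.
    by rewrite rpredB.
  case/negP: nminus; rewrite -(Gauss_dvdzl _ (p := b%:Z + b0%:Z)) //.
  by rewrite prime_pow_coprimez.
pose h (b : 'I_(P * p ^ d)) : bool * 'I_(p ^ d) :=
  ((P %| b%:Z - b0%:Z)%Z,
   Ordinal (etrans (ltn_divLR _ _ P0)
     (etrans (congr1 _ (mulnC _ _)) (ltn_ord b)))).
have h_inj : {in S &, injective h}.
  move=> x y Sx Sy [hs hq]; apply: val_inj => /=.
  rewrite (divn_eq x P) (divn_eq y P) hq; congr (_ + _)%N.
  apply/eqP; rewrite -eqz_nat -!modz_nat eqz_mod_dvd.
  case: (boolP (P %| x%:Z - b0%:Z)%Z) => hx.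
    have -> : x%:Z - y%:Z = (x%:Z - b0%:Z) - (y%:Z - b0%:Z) by ring.
    by rewrite rpredB // -hs.
  have -> : x%:Z - y%:Z = (x%:Z + b0%:Z) - (y%:Z + b0%:Z) by ring.
  by rewrite rpredB // alt // -hs.
rewrite -(card_in_image h_inj); apply: leq_trans (max_card _) _.
by rewrite card_prod card_bool card_ord.
Qed.

(** * Norms and van der Corput's inequality *)

Section Norms.

Variable R : realType.
Implicit Types z : R[i].

Lemma normE z : `|z| = (normc z)%:C. Proof. by []. Qed.

Lemma normc_ge0 z : 0 <= normc z.
Proof. by rewrite -ler0c -normE. Qed.

Lemma normc_add x z : normc (x + z) <= normc x + normc z.
Proof. by rewrite -lecR rmorphD; exact: (@ler_normD _ R[i]). Qed.

Lemma normc_opp z : normc (- z) = normc z.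
Proof. by apply: complexI; rewrite -!normE normrN. Qed.

Lemma normc_chi q x : normc (chi R q x) = 1.
Proof. by apply: complexI; rewrite -normE norm_chi. Qed.

Lemma normc_sum (I : Type) (r : seq I) (P : pred I) (F : I -> R[i]) :
  normc (\sum_(i <- r | P i) F i) <= \sum_(i <- r | P i) normc (F i).
Proof.
elim/big_rec2: _ => [|i y x _ IH]; first by rewrite normc0.
by apply: le_trans (normc_add _ _) _; rewrite lerD2l.
Qed.

(** Cauchy-Schwarz against the constant 1, from the nonnegativity of the
    variance. *)
Lemma sqr_sum_le (L : nat) (F : 'I_L -> R) :
  (\sum_i F i) ^+ 2 <= L%:R * \sum_i F i ^+ 2.
Proof.
case: L F => [|L] F; first by rewrite !big_ord0 expr0n mulr0.
set S := \sum_i F i; set T := \sum_i _; pose mu := S / L.+1%:R.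
have L0 : 0 < L.+1%:R :> R by rewrite ltr0n.
have : 0 <= \sum_i (F i - mu) ^+ 2 by apply: sumr_ge0 => i _; exact: sqr_ge0.
under eq_bigr do rewrite sqrrB.
rewrite big_split /= sumrB sumrMnl -mulr_suml sumr_const card_ord -/S -/T.
have SE : S = mu * L.+1%:R by rewrite /mu divfK ?gt_eqF.
rewrite SE -[_ ^+ 2 *+ L.+1]mulr_natl => h.
rewrite -subr_ge0; have {h} := mulr_ge0 (ltW L0) h.
by congr (0 <= _); ring.
Qed.

(** Each unit shift exchanges one term at each end. *)
Lemma sum_shift_le (g : nat -> R[i]) (L h : nat) :
  (forall n, normc (g n) = 1) ->
  normc (\sum_(n < L) g n - \sum_(n < L) g (n + h)%N) <= (2 * h)%:R.
Proof.
move=> g1; elim: h => [|h IH].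
  under [X in _ - X]eq_bigr do rewrite addn0.
  by rewrite subrr normc0.
have -> : \sum_(n < L) g (n + h.+1)%N =
    \sum_(n < L) g (n + h)%N + (g (L + h)%N - g h).
  apply/eqP; rewrite addrA eq_sym subr_eq; apply/eqP.
  rewrite -(big_ord_recr L (fun n => g (n + h)%N)) big_ord_recl /= add0n addrC.
  by congr (_ + _); apply: eq_bigr => i _; rewrite /bump /= addnS.
rewrite opprD addrA; apply: le_trans (normc_add _ _) _.
rewrite mulnS natrD [leRHS]addrC lerD //.
by rewrite normc_opp; apply: le_trans (normc_add _ _) _; rewrite normc_opp !g1.
Qed.

(** van der Corput's inequality: average the sum over its shifts by [h < H],
    at a cost of [2 H], then apply Cauchy-Schwarz and expand the square. *)
Lemma van_der_corput (g : nat -> R[i]) (L H : nat) (eps : R) :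
  (0 < H)%N -> 0 <= eps ->
  (forall n, normc (g n) = 1) ->
  (forall h h', (h < H)%N -> (h' < H)%N -> h != h' ->
     normc (\sum_(n < L) g (n + h)%N * (g (n + h')%N)^*%R) <= L%:R * eps) ->
  normc (\sum_(n < L) g n) <=
    (2 * H)%:R + L%:R * Num.sqrt (H%:R^-1 + eps).
Proof.
move=> H0 eps0 g1 corr; set S := \sum_(n < L) g n.
have H0R : 0 < H%:R :> R by rewrite ltr0n.
pose A n := normc (\sum_(h < H) g (n + h)%N).
have avg : H%:R * normc S <= H%:R * (2 * H)%:R + \sum_(n < L) A n.
  have -> : H%:R * normc S = normc (H%:R * S).
    rewrite normcM; congr (_ * _); apply: complexI.
    by rewrite -normE normr_nat rmorph_nat.
  have -> : H%:R * S = \sum_(h < H) (S - \sum_(n < L) g (n + h)%N)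
       + \sum_(n < L) \sum_(h < H) g (n + h)%N.
    rewrite [X in _ + X]exchange_big /= -big_split /=.
    under [RHS]eq_bigr do rewrite subrK.
    by rewrite sumr_const card_ord mulr_natl.
  apply: le_trans (normc_add _ _) _; apply: lerD; last exact: normc_sum.
  apply: le_trans (normc_sum _ _ _ _) _.
  rewrite [leRHS]mulr_natl -[in X in _ *+ X](card_ord H) -sumr_const.
  apply: ler_sum => h _; apply: le_trans (sum_shift_le _ _ _ g1) _.
  by rewrite ler_nat leq_mul2l /= ltnW.
have sq : \sum_(n < L) A n ^+ 2 <= L%:R * H%:R ^+ 2 * (H%:R^-1 + eps).
  set T := \sum_(n < L) A n ^+ 2.
  have TE : T%:C = \sum_(h < H) \sum_(h' < H)
      \sum_(n < L) g (n + h)%N * (g (n + h')%N)^*%R.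
    under [RHS]eq_bigr do rewrite exchange_big.
    rewrite [RHS]exchange_big /= rmorph_sum /=; apply: eq_bigr => n _.
    rewrite rmorphXn /= -normE normCK rmorph_sum mulr_suml /=.
    by apply: eq_bigr => h _; rewrite mulr_sumr.
  (* [T] is real, so passing to the norm loses nothing. *)
  have T_le : T <= normc T%:C.
    by rewrite /= expr0n addr0 sqrtr_sqr ler_norm.
  apply: le_trans T_le _; rewrite {}TE.
  have -> : L%:R * H%:R ^+ 2 * (H%:R^-1 + eps) =
      \sum_(h < H) (L%:R + \sum_(h' < H) L%:R * eps) :> R.
    rewrite big_split /= !sumr_const card_ord.
    by field; rewrite gt_eqF.
  apply: le_trans (normc_sum _ _ _ _) _; apply: ler_sum => h _.
  apply: le_trans (normc_sum _ _ _ _) _.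
  rewrite (bigD1 h) //= [in leRHS](bigD1 h) //= addrA.
  apply: lerD.
    rewrite -[leLHS]addr0; apply: lerD; last by rewrite mulr_ge0.
    apply: le_trans (normc_sum _ _ _ _) _.
    rewrite (eq_bigr (fun=> 1)) ?sumr_const ?card_ord // => n _.
    by apply: complexI; rewrite -normE normrM norm_conjC normE g1 mulr1.
  by apply: ler_sum => h' hh'; apply: corr; rewrite // eq_sym.
have sumA : \sum_(n < L) A n <= L%:R * H%:R * Num.sqrt (H%:R^-1 + eps).
  have e0 : 0 <= H%:R^-1 + eps by rewrite addr_ge0 // invr_ge0 ltW.
  rewrite -(@ler_pXn2r _ 2) ?nnegrE ?mulr_ge0 ?sqrtr_ge0 //; last first.
    by apply: sumr_ge0 => n _; exact: normc_ge0.
  apply: le_trans (sqr_sum_le _ _) _.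
  have -> : (L%:R * H%:R * Num.sqrt (H%:R^-1 + eps)) ^+ 2 =
      L%:R * (L%:R * H%:R ^+ 2 * (H%:R^-1 + eps)).
    by rewrite !exprMn sqr_sqrtr //; ring.
  by rewrite ler_wpM2l.
rewrite -(ler_pM2l H0R); apply: le_trans avg _.
by rewrite mulrDr lerD2l mulrCA mulrA.
Qed.

End Norms.

(** * Weyl sums modulo prime powers *)

Definition fdiff (f : nat -> int) (t : nat) : int := f t.+1 - f t.

Lemma fdiff_shift d (f : nat -> int) h h' t :
  iter d fdiff (fun n => f (n + h)%N - f (n + h')%N) t =
  iter d fdiff f (t + h)%N - iter d fdiff f (t + h')%N.
Proof.
elim: d t => [//|d IH] t; rewrite !iterS /fdiff !IH !addSn; ring.
Qed.

(** A function with constant first difference is affine. Applied to an iterated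
    difference, it gives the leading coefficient of a differenced phase. *)
Lemma fdiff_affine (q : nat) (f : nat -> int) (beta : int) n t :
  (forall t, (q %| fdiff f t - beta)%Z) ->
  (q %| f (t + n)%N - (f t + beta * n%:Z))%Z.
Proof.
move=> hf; elim: n => [|n IH]; first by rewrite addn0 mulr0 addr0 subrr dvdz0.
have -> : f (t + n.+1)%N - (f t + beta * n.+1%:Z) =
   (fdiff f (t + n)%N - beta) + (f (t + n)%N - (f t + beta * n%:Z)).
  by rewrite /fdiff addnS -[n.+1]addn1 PoszD; ring.
by rewrite rpredD.
Qed.

(** A nonzero integer smaller than [p ^ j] has [p]-adic valuation below [j]. *)
Lemma prime_pow_ndvd_mul (p v j : nat) (b x : int) :
  prime p -> ~~ ((p ^ v)%N %| b)%Z -> x != 0 -> (`|x| < p ^ j)%N ->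
  ~~ ((p ^ (v + j))%N %| b * x)%Z.
Proof.
move=> p_pr nb x0 xj; have b0 : b != 0 by apply: contraNneq nb => ->.
have b0' : (0 < `|b|)%N by rewrite absz_gt0.
have x0' : (0 < `|x|)%N by rewrite absz_gt0.
move: nb; rewrite !dvdzE /= abszM !pfactor_dvdn ?muln_gt0 ?b0' // lognM //.
rewrite -!ltnNge => hb; rewrite -addSn leq_add //.
apply: ltnW; rewrite -(ltn_exp2l _ _ (prime_gt1 p_pr)); apply: leq_ltn_trans xj.
by apply: dvdn_leq => //; apply: pfactor_dvdnn.
Qed.

Section Weyl.

Variable R : realType.

(** The complete periods, of length [P], cancel, and fewer than [P] terms
    remain. *)
Lemma geometric_sum_le (q P L : nat) (beta : int) : (0 < q)%N -> (0 < P)%N ->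
  (q %| beta * P%:Z)%Z -> ~~ (q %| beta)%Z ->
  normc (\sum_(n < L) chi R q (beta * n%:Z)) <= P%:R.
Proof.
move=> q0 P0 h1 h2.
have -> : \sum_(n < L) chi R q (beta * n%:Z) =
    \sum_(n < L %% P) chi R q (beta * ((L %/ P) * P + n)%N%:Z).
  rewrite -[LHS](big_mkord xpredT (fun n => chi R q (beta * n%:Z))).
  rewrite {1}(divn_eq L P) (@big_cat_nat _ _ _ (L %/ P * P)) ?leq_addr //=.
  rewrite mulnC sum_nat_div exchange_big /= big1 ?add0r => [|t _].
    rewrite -{1}[(P * _)%N]add0n big_addn addKn big_mkord.
    by apply: eq_bigr => n _; rewrite addnC mulnC.
  rewrite -[RHS](chi_sum0 R _ _ _ q0 h1 h2); apply: eq_bigr => i _.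
  apply: chi_congr => //.
  have -> : beta * (i + P * t)%N%:Z - beta * i%:Z = t%:Z * (beta * P%:Z).
    by rewrite PoszD PoszM; ring.
  exact: dvdz_mull.
apply: le_trans (normc_sum _ _ _ _ _) _.
rewrite (eq_bigr (fun=> 1)) => [|n _]; last exact: normc_chi.
by rewrite sumr_const card_ord ler_nat ltnW // ltn_mod.
Qed.

(** Iterated square roots are the savings left after iterated Cauchy-Schwarz;
    each step makes the bound weaker, but keeps it at most 1. *)
Lemma iter_sqrt_bounds (x : R) d : 0 <= x <= 1 ->
  x <= iter d Num.sqrt x <= 1.
Proof.
move=> /andP[x0 x1]; elim: d => [|d /andP[IH1 IH2]]; first by rewrite lexx.
have y0 := le_trans x0 IH1; set y := iter d _ x in IH1 IH2 y0 *.
rewrite iterS -/y; apply/andP; split; last by rewrite -sqrtr1 ler_wsqrtr.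
apply: le_trans IH1 _; rewrite -{1}[y]ger0_norm // -sqrtr_sqr ler_wsqrtr //.
by rewrite expr2 ler_piMr.
Qed.

(** Weyl differencing, in the form of van der Corput with [H = p ^ j] shifts.
    Each differencing step multiplies the leading coefficient [beta] by a
    difference of shifts, nonzero and smaller than [p ^ j] in absolute value;
    so its [p]-adic valuation grows by less than [j], and after [d] steps the
    phase is linear with a nontrivial slope of denominator at most [p ^ w]. The
    constant 5 is preserved by differencing since [2 + sqrt (1 + 5) <= 5]. *)
Lemma weyl_sum_le (p k j w L : nat) : prime p ->
  (p ^ w * p ^ j <= L)%N -> (p ^ j * p ^ j <= L)%N ->
  forall (d v : nat) (beta : int) (f : nat -> int),
  (forall t, ((p ^ k)%N %| iter d.+1 fdiff f t - beta)%Z) ->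
  ((p ^ k)%N %| beta * (p ^ w)%N%:Z)%Z -> ~~ ((p ^ v)%N %| beta)%Z ->
  (v + d * j <= k)%N ->
  normc (\sum_(n < L) chi R (p ^ k) (f n)) <=
    5 * L%:R * iter d Num.sqrt (p ^ j)%:R^-1.
Proof.
move=> p_pr wjL jjL; set q := (p ^ k)%N; set H := (p ^ j)%N.
have p0 := prime_gt0 p_pr.
have q0 : (0 < q)%N by rewrite expn_gt0 p0.
have H0 : (0 < H)%N by rewrite expn_gt0 p0.
have H0R : 0 < H%:R :> R by rewrite ltr0n.
have H01 : 0 <= (H%:R^-1 : R) <= 1.
  by rewrite invr_ge0 ltW //= invf_le1 // ler1n.
elim=> [|d IH] v beta f hf hw hv hk.
  have nq : ~~ (q %| beta)%Z.
    apply: contra hv; apply: dvdz_trans.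
    by rewrite dvdzE /= dvdn_exp2l // -[v]addn0.
  have fE n : chi R q (f n) = chi R q (f 0%N) * chi R q (beta * n%:Z).
    rewrite -chiD; apply: chi_congr => //.
    exact: (fdiff_affine q f beta n 0).
  under eq_bigr do rewrite fE.
  rewrite -mulr_sumr normcM normc_chi mul1r.
  have Pw : (0 < p ^ w)%N by rewrite expn_gt0 p0.
  apply: le_trans (geometric_sum_le _ _ L _ q0 Pw hw nq) _.
  rewrite /= ler_pdivlMr // -[leLHS]natrM.
  apply: (@le_trans _ _ (L%:R : R)); first by rewrite ler_nat.
  by rewrite ler_peMl ?ler0n ?ler1n.
have /andP[x1 x2] := iter_sqrt_bounds _ d H01.
set x := iter d _ _ in IH x1 x2 *.
have x0 : 0 < x by apply: lt_le_trans x1; rewrite invr_gt0.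
have corr h h' : (h < H)%N -> (h' < H)%N -> h != h' ->
    normc (\sum_(n < L) chi R q (f (n + h)%N) * (chi R q (f (n + h')%N))^*%R)
    <= L%:R * (5 * x).
  move=> hH h'H nhh'.
  under eq_bigr do rewrite chi_conj -chiD.
  rewrite mulrCA mulrA; apply: (IH (v + j)%N (beta * (h%:Z - h'%:Z))
    (fun n => f (n + h)%N - f (n + h')%N)).
  - move=> t; rewrite fdiff_shift.
    have ht := fdiff_affine q (iter d.+1 fdiff f) beta _ t hf.
    have := rpredB (ht h) (ht h'); congr (_ %| _)%Z.
    by ring.
  - by rewrite mulrAC dvdz_mulr.
  - apply: prime_pow_ndvd_mul => //; first by rewrite subr_eq0.
    by move: hH h'H; rewrite -/H; clear; lia.
  - by rewrite -addnA.
have := van_der_corput _ (fun n => chi R q (f n)) L H (5 * x) H0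
  (mulr_ge0 (ler0n _ _) (ltW x0)) (fun n => normc_chi _ _ _) corr.
move/le_trans; apply; rewrite iterS -/x.
have sx : x <= Num.sqrt x.
  have /andP[] // : x <= iter 1 Num.sqrt x <= 1.
  by apply: iter_sqrt_bounds; rewrite ltW.
set y := Num.sqrt x in sx *.
have y0 : 0 <= y by exact: sqrtr_ge0.
have -> : 5 * L%:R * y = 2 * L%:R * y + L%:R * (3 * y) by ring.
apply: lerD.
  rewrite natrM -mulrA ler_wpM2l //.
  apply: (@le_trans _ _ (L%:R * H%:R^-1)).
    by rewrite ler_pdivlMr // -natrM ler_nat.
  by rewrite ler_wpM2l // (le_trans x1).
rewrite ler_wpM2l //.
have -> : 3 * y = Num.sqrt (3 ^+ 2 * x).
  by rewrite sqrtrM ?sqrtr_sqr ?ger0_norm // exprn_ge0.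
by rewrite ler_wsqrtr //; lra.
Qed.

End Weyl.

(** * The Taylor polynomial of a square root *)

(** The generating function of the Catalan numbers is the fixed point of
    [Q = 1 + X Q ^ 2], reached here by iteration: the coefficients below [X ^ d]
    are the Catalan numbers. *)
Fixpoint catalan_poly (d : nat) : {poly int} :=
  if d is d'.+1 then 1 + 'X * catalan_poly d' ^+ 2 else 0.

(** The Taylor polynomial of [sqrt (1 - 4 X) = 1 - 2 X Q], up to terms of degree
    greater than [d]. *)
Definition sqrt_poly (d : nat) : {poly int} := 1 - 'X * catalan_poly d *+ 2.

(** The fixed-point iteration [Q -> 1 + X Q ^ 2] gains a coefficient per step. *)
Lemma catalan_poly_rec d : exists r : {poly int},
  catalan_poly d.+1 = catalan_poly d + 'X^d * r.
Proof.
elim: d => [|d [r IH]].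
  by exists 1; rewrite /= expr0n expr0 mulr0 add0r addr0 mulr1.
have hr : 'X^d * r = catalan_poly d.+1 - catalan_poly d.
  by rewrite IH addrC addKr.
exists (r * (catalan_poly d.+1 + catalan_poly d)).
rewrite -[catalan_poly d.+2]/(1 + 'X * catalan_poly d.+1 ^+ 2).
rewrite ['X^(d.+1)]exprS -mulrA [X in _ = _ + _ * X]mulrA hr.
have : catalan_poly d.+1 = 1 + 'X * catalan_poly d ^+ 2 by [].
move: (catalan_poly d.+1) (catalan_poly d) => b a bE.
transitivity ((1 + 'X * a ^+ 2) + 'X * ((b - a) * (b + a))); first by ring.
by rewrite -bE.
Qed.

(** With [Q] the Catalan polynomial, [(1 - 2 X Q) ^ 2 - (1 - 4 X)] equals
    [4 X (1 + X Q ^ 2 - Q)], which is [4 X] times the defect of the iteration. *)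
Lemma sqrt_poly_sqr d : exists r : {poly int},
  sqrt_poly d ^+ 2 = 1 - 'X *+ 4 + 'X^(d.+1) * r.
Proof.
have [r] := catalan_poly_rec d; rewrite /= => hr; exists (r *+ 4).
rewrite /sqrt_poly; set Q := catalan_poly d in hr *.
have -> : 'X^(d.+1) * (r *+ 4) = 'X * ('X^d * r) *+ 4 by rewrite exprS; ring.
have -> : ('X^d * r : {poly int}) = 1 + 'X * Q ^+ 2 - Q by rewrite hr; ring.
by ring.
Qed.

Lemma catalan_poly_coef_ge0 d i : 0 <= (catalan_poly d)`_i.
Proof.
elim: d i => [|d IH] i; first by rewrite coef0.
rewrite /= coefD coef1 coefXM; apply: addr_ge0; first by case: (i == 0)%N.
case: ifP => // _; rewrite expr2 coefM; apply: sumr_ge0 => k _.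
exact: mulr_ge0.
Qed.

(** In [Q -> 1 + X Q ^ 2] the product of the constant coefficient and the
    coefficient of [X ^ i] contributes positively in degree [i + 1], so
    positivity propagates by one degree per step. *)
Lemma catalan_poly_coef_gt0 d i : (i < d)%N -> 0 < (catalan_poly d)`_i.
Proof.
elim: d i => [//|d IH] [|i] hi; rewrite /= coefD coef1 coefXM //=.
rewrite add0r expr2 coefM big_ord_recl /= subn0.
have hi' : (i < d)%N by [].
apply: ltr_wpDr; last by rewrite mulr_gt0 ?IH // (leq_ltn_trans _ hi').
by apply: sumr_ge0 => k _; rewrite mulr_ge0 // catalan_poly_coef_ge0.
Qed.

Lemma coef_sqrt_poly d : (sqrt_poly d.+1)`_d.+1 = - (catalan_poly d.+1)`_d *+ 2.
Proof. by rewrite /sqrt_poly coefB coef1 coefMn coefXM /= sub0r mulNrn. Qed.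


(** * Differences of polynomial phases *)

Lemma fdiffZ d (c : int) (f : nat -> int) t :
  iter d fdiff (fun n => c * f n) t = c * iter d fdiff f t.
Proof. by elim: d t => [//|d IH] t; rewrite !iterS /fdiff !IH; ring. Qed.

Lemma fdiff_sum d n (F : nat -> nat -> int) t :
  iter d fdiff (fun s => \sum_(i < n) F i s) t =
  \sum_(i < n) iter d fdiff (F i) t.
Proof.
elim: d t => [//|d IH] t; rewrite !iterS /fdiff !IH -sumrB.
by apply: eq_bigr => i _; rewrite iterS.
Qed.

Lemma eq_fdiff d (f g : nat -> int) t : f =1 g ->
  iter d fdiff f t = iter d fdiff g t.
Proof.
by move=> fg; elim: d t => [|d IH] t; [exact: fg | rewrite !iterS /fdiff !IH].
Qed.

(** Leibniz' rule for a product with the identity. *)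
Lemma fdiff_mul_id d (f : nat -> int) t :
  iter d.+1 fdiff (fun n => n%:Z * f n) t =
  t%:Z * iter d.+1 fdiff f t + d.+1%:Z * iter d fdiff f t.+1.
Proof.
elim: d t => [|d IH] t; first by rewrite /= /fdiff -addn1 PoszD; ring.
rewrite iterS {1}/fdiff !IH.
have -> : iter d.+2 fdiff f t = iter d.+1 fdiff f t.+1 - iter d.+1 fdiff f t.
  by [].
have -> : iter d fdiff f t.+2 = iter d.+1 fdiff f t.+1 + iter d fdiff f t.+1.
  by rewrite iterS /fdiff subrK.
move: (iter _ _ _ _) (iter _ _ _ _) (iter _ _ _ _) => A B C.
by rewrite -[t.+1]addn1 -[d.+2]addn1 !PoszD; ring.
Qed.

Lemma fdiff_exp_lt d j t : (j < d)%N ->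
  iter d fdiff (fun n => n%:Z ^+ j) t = 0.
Proof.
elim: j d t => [|j IH] [//|d] t hj.
  elim: d t {hj} => [|d IH] t; first by rewrite /= /fdiff subrr.
  by rewrite iterS /fdiff !IH subrr.
rewrite (eq_fdiff _ _ (fun n => n%:Z * n%:Z ^+ j)) => [|n]; last exact: exprS.
by rewrite fdiff_mul_id !IH ?mulr0 ?addr0 // ltnW.
Qed.

Lemma fdiff_exp d t : iter d fdiff (fun n => n%:Z ^+ d) t = d`!%:Z.
Proof.
elim: d t => [//|d IH] t.
rewrite (eq_fdiff _ _ (fun n => n%:Z * n%:Z ^+ d)) => [|n]; last exact: exprS.
by rewrite fdiff_mul_id fdiff_exp_lt // mulr0 add0r IH factS PoszM.
Qed.

(** Modulo [q] the polynomial is truncated at degree [d], so its [d]-th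
    difference is the constant [d!] times its leading coefficient. *)
Lemma fdiff_horner (q d : nat) (F : {poly int}) (y : int) t :
  (q %| y ^+ d.+1)%Z ->
  (q %| iter d fdiff (fun n => F.[y * n%:Z]) t - F`_d * y ^+ d * d`!%:Z)%Z.
Proof.
move=> hy; pose N := (size F + d.+1)%N.
pose G i (n : nat) : int := F`_i * y ^+ i * n%:Z ^+ i.
rewrite (eq_fdiff _ _ (fun n => \sum_(i < N) G i n)) => [|n]; last first.
  rewrite (horner_coef_wide _ (n := N)) ?leq_addr //.
  by apply: eq_bigr => i _; rewrite /G exprMn mulrA.
rewrite fdiff_sum.
have dN : (d < N)%N by rewrite /N addnS ltnS leq_addl.
rewrite (bigD1 (Ordinal dN)) //= {1}/G fdiffZ fdiff_exp.
rewrite addrAC subrr add0r.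
apply: rpred_sum => i /negP hid; rewrite fdiffZ.
have [lt_id|lt_di|eq_id] := ltngtP i d.
  by rewrite fdiff_exp_lt // mulr0 dvdz0.
  by rewrite -(subnKC lt_di) exprD -!mulrA dvdz_mull // dvdz_mulr.
by case: hid; apply/eqP/val_inj.
Qed.

(** * Square-root bounds from stationary points *)

Section ClassBound.

Variable R : realType.

Section Family.

Variables (p m d : nat) (a : int).
Hypotheses (p_pr : prime p) (p_odd : odd p) (m_gt0 : (0 < m)%N).
Hypothesis cap : coprimez a p.

Let P := (p ^ m)%N.
Let W := (p ^ m * p ^ d)%N.
Let q := (P * W)%N.

Let p_gt0 : (0 < p)%N. Proof. exact: prime_gt0. Qed.
Let P_gt0 : (0 < P)%N. Proof. by rewrite expn_gt0 p_gt0. Qed.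
Let W_gt0 : (0 < W)%N. Proof. by rewrite muln_gt0 P_gt0 expn_gt0 p_gt0. Qed.
Let q_gt0 : (0 < q)%N. Proof. by rewrite muln_gt0 P_gt0. Qed.
Let p_dvd_P : (p %| P)%N.
Proof. by rewrite /P -(prednK m_gt0) expnS dvdn_mulr. Qed.
Let a_unit : ~~ (p %| a)%Z.
Proof. by rewrite -prime_coprimez // coprimez_sym. Qed.

Definition stationary_phase (n : int) (b : nat) : int :=
  n * b%:Z + a * (modinv q b)%:Z.

(** The scaled sums [K(n u, a u)] with [u] a unit all have the same stationary
    points, those of [K(n, a)]; there are at most [2 p ^ d] of them. *)
Lemma kloosterman_family_le (n : int) (L : nat) (U : nat -> int) (E : R) :
  0 <= E -> (forall t, ~~ (p %| U t)%Z) ->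
  (forall b : nat, coprime b W -> (P %| n * b%:Z ^+ 2 - a)%Z ->
     normc (\sum_(t < L) chi R q (U t * stationary_phase n b)) <= E) ->
  normc (\sum_(t < L) kloosterman R (n * U t) (a * U t) q) <=
    (2 * p ^ (m + d))%:R * E.
Proof.
move=> E0 Uunit hE.
have PW : (P %| W)%N by exact: dvdn_mulr.
pose S := [pred b : 'I_W | coprime b W && (P %| n * b%:Z ^+ 2 - a)%Z].
have step t : kloosterman R (n * U t) (a * U t) q =
    P%:R * \sum_(b in S) chi R q (U t * stationary_phase n b).
  rewrite kloosterman_stationary //; congr (_ * _).
  apply: eq_big => [b|b _].
    rewrite inE /=; congr (_ && _).
    have -> : n * U t * b%:Z ^+ 2 - a * U t = U t * (n * b%:Z ^+ 2 - a) by ring.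
    by rewrite Gauss_dvdzr // prime_pow_coprimez.
  by congr (chi R _ _); rewrite /stationary_phase; ring.
under eq_bigr do rewrite step.
rewrite -mulr_sumr exchange_big /= normcM.
have -> : normc (P%:R : R[i]) = P%:R.
  by apply: complexI; rewrite -normE normr_nat rmorph_nat.
have cardS : (#|S| <= 2 * p ^ d)%N.
  apply: leq_trans (card_sqrt_le _ m d n _ p_pr p_odd m_gt0 cap).
  apply: subset_leq_card; apply/subsetP => b.
  by rewrite !inE => /andP[].
apply: (@le_trans _ _ (P%:R * (#|S|%:R * E))).
  rewrite ler_wpM2l //; apply: le_trans (normc_sum _ _ _ _ _) _.
  rewrite mulr_natl -sumr_const; apply: ler_sum => b.
  by rewrite inE => /andP[cb hb]; apply: hE.
rewrite mulrA ler_wpM2r // -natrM ler_nat expnD mulnCA.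
by rewrite leq_mul2l cardS orbT.
Qed.

Lemma p_ndvd2 : ~~ (p %| 2)%Z.
Proof.
rewrite dvdzE /=; apply/negP => /(dvdn_leq (isT : (0 < 2)%N)).
by case: (p) p_pr p_odd => [|[|[|]]].
Qed.

Lemma p_ndvd_mul (x y : int) :
  ~~ (p %| x)%Z -> ~~ (p %| y)%Z -> ~~ (p %| x * y)%Z.
Proof. by move=> hx hy; rewrite Gauss_dvdzr // prime_coprimez. Qed.

(** At a stationary point [n b = a / b], so the phase is [2 a / b]. *)
Lemma stationary_phase_unit (n : int) (b : nat) :
  coprime b W -> (P %| n * b%:Z ^+ 2 - a)%Z -> ~~ (p %| stationary_phase n b)%Z.
Proof.
move=> cb hb.
have pW : (p %| W)%N by exact: dvdn_mulr.
have cbp : coprime b p by exact: coprime_dvdr cb.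
have cbq : coprime b q.
  by rewrite coprimeMr cb andbT coprimeXr.
have hi := modinv_dvd _ _ q_gt0 cbq.
have pq : (p %| q)%N by exact: dvdn_mulr.
rewrite /stationary_phase; set c := (modinv q b)%:Z in hi *.
apply/negP => hz; have /negP := p_ndvd_mul _ _ p_ndvd2 a_unit; apply.
have -> : 2 * a = b%:Z * (n * b%:Z + a * c) - (n * b%:Z ^+ 2 - a)
  - a * (b%:Z * c - 1) by ring.
rewrite rpredB ?dvdz_mull //; last by apply: dvdz_trans hi.
by rewrite rpredB ?dvdz_mull //; apply: dvdz_trans hb.
Qed.

Lemma kloosterman_le (n : int) :
  normc (kloosterman R n a q) <= (2 * p ^ (m + d))%:R.
Proof.
have := kloosterman_family_le n 1 (fun=> 1) 1 ler01.
rewrite !big_ord1 !mulr1; apply=> [_|b _ _].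
  by rewrite dvdz1 /= eqn_leq leqNgt prime_gt1.
by rewrite big_ord1 normc_chi.
Qed.

(** No stationary points: [p | n] and [p | n b ^ 2 - a] would give [p | a]. *)
Lemma kloosterman_eq0 (n : int) : (p %| n)%Z -> kloosterman R n a q = 0.
Proof.
move=> pn; apply: eq0_normc; apply/eqP; rewrite eq_le normc_ge0 andbT.
have := kloosterman_family_le n 1 (fun=> 1) 0 (lexx _).
rewrite !big_ord1 !mulr1 mulr0; apply=> [_|b _ hb].
  by rewrite dvdz1 /= eqn_leq leqNgt prime_gt1.
case/negP: a_unit.
have -> : a = b%:Z ^+ 2 * n - (n * b%:Z ^+ 2 - a) by ring.
by rewrite rpredB ?dvdz_mull //; apply: dvdz_trans hb.
Qed.

End Family.

End ClassBound.

(** * Kloosterman sums over residue classes and intervals *)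

Lemma Posz_exp (a b : nat) : (a ^ b)%N%:Z = a%:Z ^+ b.
Proof. by elim: b => [//|b IH]; rewrite expnS PoszM IH exprS. Qed.

(** The [D]-th difference of [sqrt_poly D] with its terms of higher degree
    dropped. It is nonzero and depends on [D] only, so its [p]-adic valuation is
    bounded independently of [p]. *)
Definition sqrt_lead (D : nat) : int := (sqrt_poly D)`_D * D`!%:Z.

Lemma sqrt_lead_neq0 D : sqrt_lead D.+1 != 0.
Proof.
rewrite /sqrt_lead coef_sqrt_poly mulf_neq0 //; last first.
  by rewrite eqz_nat -lt0n fact_gt0.
have := catalan_poly_coef_gt0 D.+1 D (ltnSn D).
by move: (_`_D) => x; lia.
Qed.

(** On the class of [n] modulo [p ^ s] write [n + p ^ s t = n (1 - 4 y)] with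
    [y = g p ^ s t] and [g = - 1 / (4 n)]. The Taylor polynomial is an exact
    square root of [1 - 4 y] modulo [p ^ k], because [y ^ (D + 1)] vanishes
    there; it is a unit because it is 1 modulo [p]. *)
Lemma sqrt_poly_class (p k s D : nat) (n : int) :
  prime p -> odd p -> (0 < s)%N -> (0 < k)%N -> (k <= s * D.+1)%N ->
  ~~ (p %| n)%Z ->
  exists2 g : int, ~~ (p %| g)%Z &
    (forall t : nat, ~~ (p %| (sqrt_poly D).[g * (p ^ s)%N%:Z * t%:Z])%Z) /\
    (forall t : nat, ((p ^ k)%N %| n + (p ^ s)%N%:Z * t%:Z
       - n * (sqrt_poly D).[g * (p ^ s)%N%:Z * t%:Z] ^+ 2)%Z).
Proof.
move=> p_pr p_odd s0 k0 ks pn; set q := (p ^ k)%N; set S := (p ^ s)%N.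
have p2 := p_ndvd2 p p_pr p_odd.
have p4 : ~~ (p %| - (4 * n))%Z.
  rewrite rpredN; have -> : 4 * n = 2 * (2 * n) by ring.
  by rewrite !p_ndvd_mul.
have c4 : coprimez (- (4 * n)) q.
  by rewrite coprimez_sym prime_pow_coprimez.
have pq : (p %| q)%N by rewrite /q -(prednK k0) expnS dvdn_mulr.
have pS : (p %| S)%N by rewrite /S -(prednK s0) expnS dvdn_mulr.
have [g hg] := modz_coprime_inv _ _ c4; exists g.
  apply/negP => pg; have : (p %| 1%R)%Z.
    have -> : 1%R = - (4 * n) * g - (- (4 * n) * g - 1) by ring.
    by rewrite rpredB ?dvdz_mull //; apply: dvdz_trans hg.
  by rewrite dvdz1 /= => /eqP p1; move: p_pr; rewrite p1.
split=> t; set x := g * S%:Z * t%:Z.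
  rewrite /sqrt_poly !hornerE.
  set Q := (_ D).[x]; apply/negP => pU; have : (p %| 1%R)%Z.
    have -> : 1%R = (1 - (x * Q + x * Q)) + (Q * g * t%:Z) *+ 2 * S%:Z.
      by rewrite /x; ring.
    by rewrite rpredD // dvdz_mull.
  by rewrite dvdz1 /= => /eqP p1; move: p_pr; rewrite p1.
have [r hr] := sqrt_poly_sqr D.
have -> : (sqrt_poly D).[x] ^+ 2 = 1 - x *+ 4 + x ^+ D.+1 * r.[x].
  rewrite -horner_exp hr.
  by rewrite !(hornerD, hornerN, hornerMn, hornerX, hornerM, hornerXn) hornerC.
have qx : (q %| x ^+ D.+1)%Z.
  rewrite /x !exprMn mulrAC dvdz_mull // -Posz_exp -expnM.
  by rewrite dvdzE /= dvdn_exp2l.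
have -> : n + S%:Z * t%:Z - n * (1 - x *+ 4 + x ^+ D.+1 * r.[x]) =
  - (S%:Z * t%:Z) * (- (4 * n) * g - 1) - n * r.[x] * x ^+ D.+1.
  by rewrite {1}/x; ring.
by rewrite rpredB // dvdz_mull.
Qed.

(** If [p | n] every term vanishes. Otherwise the parameter is [n u ^ 2] with
    [u] a polynomial of degree [D + 1] in the position along the class, modulo
    [p ^ k]; since [u] can be moved in front of the whole phase, the stationary
    points are independent of the position, and what remains for each of them is
    a Weyl sum. *)
Lemma kloosterman_class_le (R : realType) (p m d D s j L : nat) (n a : int) :
  prime p -> odd p -> (0 < m)%N -> coprimez a p -> (0 < s)%N ->
  (s * D.+1 + `|sqrt_lead D.+1| + D * j <= m + (m + d) <= s * D.+2)%N ->
  (p ^ (m + (m + d) - s * D.+1) * p ^ j <= L)%N ->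
  (p ^ j * p ^ j <= L)%N ->
  normc (\sum_(t < L) kloosterman R (n + (p ^ s)%N%:Z * t%:Z) a
           (p ^ m * (p ^ m * p ^ d))) <=
    (2 * p ^ (m + d))%:R * (5 * L%:R * iter D Num.sqrt (p ^ j)%:R^-1).
Proof.
move=> p_pr p_odd m0 cap s0 /andP[hk1 hk2] wL jL.
set q := (p ^ m * _)%N; set E := 5 * _ * _.
set k := (m + (m + d))%N in hk1 hk2 wL *.
have p0 := prime_gt0 p_pr; have p1 := prime_gt1 p_pr.
have qE : q = (p ^ k)%N by rewrite /q /k !expnD.
have k0 : (0 < k)%N by rewrite /k addn_gt0 m0.
have q0 : (0 < q)%N by rewrite qE expn_gt0 p0.
have E0 : 0 <= E.
  rewrite !mulr_ge0 //.
  by case: (D) => [|D'] /=; rewrite ?invr_ge0 ?ler0n ?sqrtr_ge0.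
case: (boolP (p %| n)%Z) => pn.
  rewrite big1 ?normc0 ?(mulr_ge0 (ler0n _ _) E0) // => t _.
  apply: kloosterman_eq0 => //.
  have pS : (p %| p ^ s)%N by rewrite -(prednK s0) expnS dvdn_mulr.
  by rewrite rpredD //; apply: dvdz_mulr.
have [g pg [Uunit hU]] :=
  sqrt_poly_class p k s D.+1 n p_pr p_odd s0 k0 hk2 pn.
set y := g * _ in Uunit hU.
pose U (t : nat) := (sqrt_poly D.+1).[y * t%:Z].
have KU t : kloosterman R (n + (p ^ s)%N%:Z * t%:Z) a q =
    kloosterman R (n * U t) (a * U t) q.
  rewrite -kloosterman_square //; last first.
    by rewrite coprimez_sym qE prime_pow_coprimez //; apply: Uunit.
  by apply: kloosterman_congr => //; rewrite qE; apply: hU.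
under eq_bigr do rewrite KU.
apply: kloosterman_family_le => // b cb hb.
set z := stationary_phase _ _ _ _ _ _.
have pz : ~~ (p %| z)%Z by apply: stationary_phase_unit.
rewrite -/q qE.
have yE : y ^+ D.+1 = g ^+ D.+1 * (p ^ (s * D.+1))%N%:Z.
  by rewrite /y exprMn -Posz_exp -expnM.
have betaE : (z *: sqrt_poly D.+1)`_D.+1 * y ^+ D.+1 * D.+1`!%:Z =
    (p ^ (s * D.+1))%N%:Z * (z * g ^+ D.+1 * sqrt_lead D.+1).
  by rewrite coefZ yE /sqrt_lead; ring.
have pg' : ~~ (p %| g ^+ D.+1)%Z.
  elim: (D.+1) => [|i IH]; last by rewrite exprS p_ndvd_mul.
  by rewrite expr0 dvdz1 /= eqn_leq leqNgt p1.
apply: (weyl_sum_le R p k j (k - s * D.+1)%N L p_pr wL jL D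
  (s * D.+1 + `|sqrt_lead D.+1|)%N
  ((z *: sqrt_poly D.+1)`_D.+1 * y ^+ D.+1 * D.+1`!%:Z)
  (fun t => U t * z)) => //.
- move=> t; rewrite (eq_fdiff _ _ (fun n => (z *: sqrt_poly D.+1).[y * n%:Z])).
    apply: fdiff_horner; rewrite /y exprMn dvdz_mull // -Posz_exp -expnM.
    by rewrite dvdzE /= dvdn_exp2l.
  by move=> t'; rewrite hornerZ mulrC.
- rewrite betaE mulrAC -PoszM -expnD subnKC; last first.
    by apply: leq_trans hk1; rewrite -addnA leq_addr.
  by rewrite dvdz_mulr ?dvdzz.
rewrite betaE expnD PoszM dvdz_mul2l; last first.
  by rewrite eqz_nat -lt0n expn_gt0 p0.
rewrite Gauss_dvdzr; last by rewrite prime_pow_coprimez // p_ndvd_mul.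
(* [p ^ C] does not divide a nonzero integer of absolute value [C < p ^ C]. *)
rewrite dvdzE /= gtnNdvd ?absz_gt0 ?sqrt_lead_neq0 //.
exact: ltn_expl.
Qed.

(** Split [1 .. N] into the residue classes modulo [p ^ s] and fewer than
    [p ^ s] leftover terms, each of which has square-root size. *)
Lemma kloosterman_sum_le (R : realType) (p m d D s j N : nat) (a : int) :
  prime p -> odd p -> (0 < m)%N -> coprimez a p -> (0 < s)%N ->
  (s * D.+1 + `|sqrt_lead D.+1| + D * j <= m + (m + d) <= s * D.+2)%N ->
  (m + (m + d) - s * D.+1 + j <= s)%N -> (j + j <= s)%N ->
  (p ^ s * p ^ s <= N)%N ->
  normc (\sum_(1 <= n < N.+1)
           kloosterman R n%:Z a (p ^ m * (p ^ m * p ^ d))) <=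
    12 * N%:R * (p ^ (m + d))%:R * iter D Num.sqrt (p ^ j)%:R^-1.
Proof.
move=> p_pr p_odd m0 cap s0 hk ws js SN.
set q := (p ^ m * _)%N; set S := (p ^ s)%N; set x := iter _ _ _.
have p0 := prime_gt0 p_pr.
have S0 : (0 < S)%N by rewrite expn_gt0 p0.
pose L := (N %/ S)%N.
have SL : (S <= L)%N by rewrite /L leq_divRL.
have SLN : (S * L <= N)%N by rewrite mulnC leq_trunc_div.
have jS : (p ^ j <= S)%N by rewrite leq_pexp2l // (leq_trans _ js) // leq_addr.
have J0 : 0 < (p ^ j)%:R :> R by rewrite ltr0n expn_gt0 p0.
have /andP[x1 x2] : (p ^ j)%:R^-1 <= x <= 1.
  apply: iter_sqrt_bounds; rewrite invr_ge0 ltW //= invf_le1 //.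
  by rewrite ler1n expn_gt0 p0.
have x0 : 0 <= x by apply: le_trans x1; rewrite invr_ge0 ltW.
rewrite big_add1 /= (@big_cat_nat _ _ _ (S * L)) //= sum_nat_div.
have main : normc (\sum_(i < S) \sum_(t < L)
    kloosterman R (i + S * t).+1%:Z a q) <= 10 * N%:R * (p ^ (m + d))%:R * x.
  apply: le_trans (normc_sum _ _ _ _ _) _.
  apply: (@le_trans _ _ (S%:R * ((2 * p ^ (m + d))%:R * (5 * L%:R * x)))).
    rewrite mulr_natl -[in X in _ *+ X](card_ord S) -sumr_const.
    apply: ler_sum => i _.
    have -> : \sum_(t < L) kloosterman R (i + S * t).+1%:Z a q =
        \sum_(t < L) kloosterman R (i.+1%:Z + S%:Z * t%:Z) a q.
      by apply: eq_bigr => t _; rewrite -addSn PoszD PoszM.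
    apply: kloosterman_class_le => //.
      by apply: leq_trans SL; rewrite -expnD leq_pexp2l.
    by apply: leq_trans SL; rewrite -expnD leq_pexp2l.
  have -> : S%:R * ((2 * p ^ (m + d))%:R * (5 * L%:R * x)) =
      10 * (S * L)%:R * (p ^ (m + d))%:R * x :> R by rewrite !natrM; ring.
  by rewrite ler_wpM2r // ler_wpM2r // ler_wpM2l // ler_nat.
have rest : normc (\sum_(S * L <= i < N) kloosterman R i.+1%:Z a q) <=
    2 * N%:R * (p ^ (m + d))%:R * x.
  apply: le_trans (normc_sum _ _ _ _ _) _.
  apply: (@le_trans _ _ (S%:R * (2 * p ^ (m + d))%:R)).
    apply: (@le_trans _ _ (\sum_(S * L <= i < N) (2 * p ^ (m + d))%:R)).
      by apply: ler_sum => i _; apply: kloosterman_le.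
    rewrite sumr_const_nat -[leLHS]mulr_natl ler_wpM2r // ler_nat.
    by rewrite leq_subLR {1}(divn_eq N S) mulnC leq_add2l ltnW // ltn_mod.
  have SNx : S%:R <= N%:R * x.
    apply: (@le_trans _ _ (N%:R * (p ^ j)%:R^-1)); last by rewrite ler_wpM2l.
    rewrite ler_pdivlMr // -natrM ler_nat; apply: leq_trans SN.
    by rewrite leq_mul2l jS orbT.
  have -> : 2 * N%:R * (p ^ (m + d))%:R * x = N%:R * x * (2 * p ^ (m + d))%:R.
    by rewrite natrM; ring.
  by rewrite ler_wpM2r.
apply: le_trans (normc_add _ _ _) _; apply: le_trans (lerD main rest) _.
by rewrite le_eqVlt; apply/orP; left; apply/eqP; ring.
Qed.

Lemma iter_sqrt_powR (R : realType) (a r : R) D :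
  iter D Num.sqrt (a `^ r) = a `^ (r / 2 ^+ D).
Proof.
elim: D => [|D IH]; first by rewrite divr1.
rewrite iterS IH -powR12_sqrt ?powR_ge0 // -powRrM; congr (_ `^ _).
by rewrite exprSr invfM mulrA.
Qed.

Theorem theorem1p2 (R : realType) (lambda : R) (lambda_gt0 : 0 < lambda) :
  exists (k0 : nat) (tau c : R), [/\ 0 < tau, 0 < c &
    forall (p k : nat) (a : int) (N : R),
      let q := (p ^ k)%N in
      prime p -> odd p -> (k0 <= k)%N -> coprimez a p%:Z ->
      q%:R `^ lambda <= N -> N <= q%:R ->
      `| \sum_(1 <= n < (Num.truncn N).+1) kloosterman R n%:Z a q |
        <= (c * (N * q%:R `^ (2^-1 - tau)))%:C ].
Proof.
(* The Taylor series is cut at degree [D + 1]. All the lengths below are powers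
   [p ^ (r j)] with [r] bounded in terms of [D]: the classes are taken modulo
   [p ^ s] with [s = sigma j], and [sigma], [M] are such that
   [s (D + 1) + (D + 1) j <= k] (room for the differencing, the slope staying
   nontrivial) and [k + j <= s (D + 2)] (truncation of the Taylor series, and
   slopes of denominator at most [p ^ (s - j)]), while
   [2 / lambda <= D + 1] gives [p ^ (2 s) <= q ^ lambda <= N]. *)
pose D := Num.truncn (2 / lambda).
have D_large : 2 <= lambda * D.+1%:R.
  rewrite -ler_pdivrMl // mulrC ltW //.
  by have /andP[] := truncn_itv (divr_ge0 (ler0n R 2) (ltW lambda_gt0)).
pose sigma := (D + 4)%N.
pose M := (sigma * D.+1 + D.+2)%N.
pose C := `|sqrt_lead D.+1|%N.
exists (M * (M + C + 2 ^ D.+1))%N, (2 ^+ D.+1 * M.+1%:R)^-1, 12.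
split=> [||p k a N q p_pr p_odd k0k cap qN Nq].
- by rewrite invr_gt0 mulr_gt0 // exprn_gt0.
- by [].
have M0 : (0 < M)%N by rewrite /M addnS.
pose j := (k %/ M)%N.
have j_large : (M + C + 2 ^ D.+1 <= j)%N by rewrite /j leq_divRL // mulnC.
have kj1 : (M * j <= k)%N by rewrite mulnC leq_trunc_div.
(* As [M <= j], the remainder of [k] modulo [M] costs at most one more [j]. *)
have kj2 : (k <= M.+1 * j)%N.
  rewrite {1}(divn_eq k M) -/j mulSn addnC mulnC leq_add2r.
  apply: ltnW; apply: leq_trans (ltn_pmod k M0) _.
  by apply: leq_trans j_large; rewrite -addnA leq_addr.
have j0 : (0 < j)%N.
  by apply: leq_trans j_large; rewrite -addnA ltn_addr.
pose s := (sigma * j)%N; pose m := k./2; pose d : nat := odd k.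
have p0 := prime_gt0 p_pr; have p1 := prime_gt1 p_pr.
have p0R : 0 < p%:R :> R by rewrite ltr0n.
have p0R' := ltW p0R.
have p1R : 1 <= p%:R :> R by rewrite ler1n.
have kE : (k = m + (m + d))%N.
  by rewrite /m /d addnA addnn addnC odd_double_half.
have qE : q = (p ^ m * (p ^ m * p ^ d))%N by rewrite -!expnD -kE.
have qR : q%:R = p%:R `^ k%:R :> R by rewrite powR_mulrn ?natrX.
have N0 : 0 <= N by apply: le_trans qN; apply: powR_ge0.
have sqN : (p ^ s * p ^ s <= Num.truncn N)%N.
  rewrite -expnD truncn_ge_nat //.
  apply: le_trans qN; rewrite natrX -powR_mulrn // qR -powRrM.
  apply: ler_powR => //.
  have : (M * j)%:R <= k%:R :> R by rewrite ler_nat.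
  rewrite /s -mulnDl natrM => kj.
  apply: (@le_trans _ _ (lambda * (M%:R * j%:R))); last first.
    by rewrite mulrC ler_wpM2r // ltW.
  rewrite natrM mulrA ler_wpM2r //.
  have : 2 * sigma%:R <= lambda * D.+1%:R * sigma%:R by rewrite ler_wpM2r.
  rewrite natrD /M [(sigma * _ + _)%N%:R]natrD natrM.
  have : 0 <= lambda * D.+2%:R by rewrite mulr_ge0 // ltW.
  by move: (D.+1%:R) (D.+2%:R) (sigma%:R) => A B E; nra.
have Cj : (C <= j)%N by apply: leq_trans j_large; rewrite addnAC leq_addl.
have sE : s = (D * j + 4 * j)%N by rewrite /s /sigma mulnDl.
have MjE : (M * j = s * D.+1 + D * j + 2 * j)%N.
  by rewrite /M mulnDl -mulnA [(D.+1 * j)%N]mulnC mulnA -addn2 mulnDl addnA.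
have hk : (s * D.+1 + C + D * j <= m + (m + d) <= s * D.+2)%N.
  rewrite -kE [(s * D.+2)%N]mulnS.
  by move: kj1 kj2 Cj sE MjE; rewrite mulSn; clear; lia.
have ws : (m + (m + d) - s * D.+1 + j <= s)%N.
  by rewrite -kE; move: kj2 sE MjE; rewrite mulSn; clear; lia.
rewrite qE -[`|_|]/((normc _)%:C) lecR.
have := kloosterman_sum_le R p m d D s j (Num.truncn N) a p_pr p_odd.
move/(_ _ cap _ hk ws _ sqN)/le_trans; apply.
- by rewrite /m; move: kj1 MjE j0; clear; lia.
- by rewrite sE; move: j0; clear; lia.
- by rewrite sE; clear; lia.
rewrite -qE qR -powRrM -!mulrA ler_wpM2l //.
have -> : (p ^ j)%:R^-1 = p%:R `^ (- j%:R) :> R.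
  by rewrite powRN natrX powR_mulrn.
rewrite iter_sqrt_powR natrX -powR_mulrn //.
rewrite -powRD; last by rewrite (gt_eqF p0R) implybT.
apply: ler_pM => //; first exact: powR_ge0.
  by have /andP[] := truncn_itv N0.
apply: ler_powR => //.
(* It remains to compare exponents of [p]: the saving [j / 2 ^ D] pays for the
   rounding of [k / 2] and for [tau k <= j / 2 ^ (D + 1)]. *)
set T := 2 ^+ D; have T0 : 0 < T by rewrite exprn_gt0.
have kR : k%:R <= M.+1%:R * j%:R :> R by rewrite -natrM ler_nat.
have jT : 2 * T <= j%:R.
  rewrite /T -exprS -natrX ler_nat; apply: leq_trans j_large.
  by rewrite leq_addl.
have tau_le : k%:R * (2 ^+ D.+1 * M.+1%:R)^-1 <= j%:R / T / 2.
  rewrite ler_pdivrMr ?mulr_gt0 ?exprn_gt0 // exprS -/T.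
  have -> : j%:R / T / 2 * (2 * T * M.+1%:R) = M.+1%:R * j%:R.
    by field; rewrite gt_eqF.
  exact: kR.
have half : 2^-1 <= j%:R / T / 2 - 2^-1.
  have : 2 <= j%:R / T by rewrite ler_pdivlMr.
  by lra.
have mdk : (m + d)%:R <= k%:R / 2 + 2^-1 :> R.
  have : ((m + d) * 2)%:R <= k.+1%:R :> R.
    rewrite ler_nat; move: kE (leq_b1 (odd k)); rewrite -/d.
    by move: (m) (d); clear; lia.
  by rewrite natrM -[k.+1%:R]natr1; lra.
rewrite mulrBr mulNr; move: tau_le half mdk.
move: (j%:R / T) (k%:R / (2 ^+ D.+1 * M.+1%:R)) ((m + d)%N%:R : R).
by move=> X Y Z; clear; lra.
Qed.
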